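(* Let $q$ be a prime power, let $X$ be a vector space over $\mathbb{F}_q$ of finite dimension $n\ge 1$, and let $A \subseteq X$ be a subset. For all $k \in \mathbb{N}$ we have $$\alpha_k(X,A)= \sum_{i=0}^k w_i(\mathcal{L}(A)) \begin{bmatrix} n-i \\ k-i \end{bmatrix}_q.$$
   Context: $\mathbb{N}$ includes $0$. $\begin{bmatrix} r\\ s\end{bmatrix}_q$ is the $q$-binomial coefficient ($0$ if $s<0$ or $s>r$). For $A\subseteq X$, $\mathcal{L}(A)$ is the lattice, ordered by inclusion, of those subspaces of $X$ that have a basis made of elements of $A$, together with the zero space; it is a finite geometric lattice whose rank function is the $\mathbb{F}_q$-dimension. With $\mu_A$ its Möbius function, its $i$-th Whitney number (of the first kind) is $w_i(\mathcal{L}(A))=\sum_{U\in\mathcal{L}(A),\ \dim U=i}\mu_A(\{0\},U)$ (an empty sum is $0$). The number $\alpha_k(X,A)$ is the number of $k$-dimensional subspaces $V\le X$ that distinguish (avoid) $A$, i.e. with $V\cap A=\emptyset$ or $V\cap A=\{0\}$. *)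

(* Defs.v *)
From HB Require Import structures.
From mathcomp Require Import all_boot all_order all_algebra all_field.

Set Implicit Arguments.
Unset Strict Implicit.
Unset Printing Implicit Defensive.

Import Order.TTheory GRing.Theory Num.Theory.
Local Open Scope ring_scope.

Section QBinomial.

Definition qbinom_num (q r s : nat) : nat :=
  (\prod_(i < s) (q ^ (r - i) - 1))%N.
Definition qbinom_den (q s : nat) : nat :=
  (\prod_(i < s) (q ^ i.+1 - 1))%N.

(* The arguments are integers so that the value is 0 also when [r < 0], as
   happens for [r = n - i] with [i > n]. The quotient of natural numbers is
   exact, see [dvdn_qbinom]. *)
Definition qbinom (q : nat) (r s : int) : nat :=
  if (0 <= s) && (s <= r)
  then (qbinom_num q `|r| `|s| %/ qbinom_den q `|s|)%N
  else 0%N.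

Lemma dvdn_qbinom (q r s : nat) :
  (0 < q)%N -> (qbinom_den q s %| qbinom_num q r s)%N.
Proof.
rewrite /qbinom_den /qbinom_num => q0.
elim: r s => [|r IH] [|s]; rewrite ?big_ord0 //.
  by rewrite [X in (_ %| X)%N]big_ord_recl /= expn0 subnn mul0n dvdn0.
rewrite [X in (_ %| X)%N]big_ord_recl /= subn0.
under [X in (_ %| _ * X)%N]eq_bigr => i _ do rewrite /bump add1n subSS.
have [ltrs|lesr] := ltnP r s.
  rewrite (bigD1 (Ordinal ltrs) (P := xpredT)) //= subnn expn0 subnn mul0n.
  by rewrite muln0 dvdn0.
have -> : (q ^ r.+1 - 1 = q ^ s.+1 * (q ^ (r - s) - 1) + (q ^ s.+1 - 1))%N.
  have q1 e : (1 <= q ^ e)%N by rewrite expn_gt0 q0.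
  rewrite mulnBr -expnD muln1 addSn subnKC // addnBA //.
  by rewrite subnK // leq_pexp2l.
rewrite mulnDl; apply: dvdn_add.
  rewrite -mulnA; apply: dvdn_mull.
  by have := IH s.+1; rewrite [X in (_ %| X)%N]big_ord_recr /= mulnC.
rewrite big_ord_recr /= mulnC.
by apply: dvdn_mul; last exact: IH.
Qed.

End QBinomial.

Section Mobius.
Variables (d : Order.disp_t) (T : finPOrderType d).
Implicit Types x y z : T.

(* [m] is a recursion depth; [#|T|] steps suffice, see [mobius_xx],
   [mobius_lt] and [mobius_nle] for the defining equations of [mobius]. *)
Fixpoint mobius_rec (m : nat) x y : int :=
  if m is m'.+1 then
    if x == y then 1
    else if (x < y)%O then - \sum_(z | (x <= z < y)%O) mobius_rec m' x z
    else 0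
  else 0.

Definition mobius x y : int := mobius_rec #|T| x y.

Lemma mobius_rec_stable m1 m2 x y :
  (#|[set z | (z <= y)%O]| <= m1)%N -> (#|[set z | (z <= y)%O]| <= m2)%N ->
  mobius_rec m1 x y = mobius_rec m2 x y.
Proof.
have pos z : (0 < #|[set t | (t <= z)%O]|)%N.
  by apply/card_gt0P; exists z; rewrite inE.
elim: m1 m2 y => [|m1 IH] [|m2] y; rewrite ?leqn0.
- by [].
- by move=> /eqP h; have := pos y; rewrite h.
- by move=> _ /eqP h; have := pos y; rewrite h.
move=> h1 h2 /=; case: eqP => // _; case: ifP => // _; congr (- _).
apply: eq_bigr => z /andP[_ ltzy].
have h : (#|[set t | (t <= z)%O]| < #|[set t | (t <= y)%O]|)%N.
  apply/proper_card/properP; split.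
    by apply/subsetP => t; rewrite !inE => /le_trans; apply; apply: ltW.
  by exists y; rewrite !inE // lt_geF.
by apply: IH; rewrite -ltnS; apply: leq_trans h _.
Qed.

Lemma mobius_xx x : mobius x x = 1.
Proof.
by rewrite /mobius (cardD1 x) inE /= eqxx.
Qed.

Lemma mobius_nle x y : ~~ (x <= y)%O -> mobius x y = 0.
Proof.
rewrite /mobius (cardD1 x) inE /= => h.
case: eqP h => [->|_ h]; first by rewrite lexx.
by case: ifP => // /ltW; rewrite (negbTE h).
Qed.

Lemma mobius_lt x y :
  (x < y)%O -> mobius x y = - \sum_(z | (x <= z < y)%O) mobius x z.
Proof.
move=> ltxy.
have -> : mobius x y = mobius_rec #|T|.+1 x y.
  by apply: mobius_rec_stable; [|apply: leqW]; apply: max_card.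
by rewrite /= lt_eqF // ltxy.
Qed.

End Mobius.

Section SubspaceFinite.
Import VectorInternalTheory.
Variables (F : finFieldType) (X : vectType F).

HB.instance Definition _ := [Finite of {vspace X} by <:].

End SubspaceFinite.

Section SubspaceOrder.
Variables (F : fieldType) (X : vectType F).

Fact subspace_display : Order.disp_t. Proof. exact: Order.Disp tt tt. Qed.

Fact subspace_le_anti : antisymmetric (@subsetv F X).
Proof. by move=> U V h; apply/eqP; rewrite eqEsubv. Qed.

Fact subspace_le_trans : transitive (@subsetv F X).
Proof. by move=> V U W; apply: subv_trans. Qed.

HB.instance Definition _ := Order.Le_isPOrder.Build subspace_display {vspace X}
  (@subvv F X) subspace_le_anti subspace_le_trans.

End SubspaceOrder.

Section LatticeOfSet.
Variables (F : finFieldType) (X : vectType F).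
(* [finvect_type X] is [X] equipped with its structure of finite type. *)
Variable A : {set finvect_type X}.

Definition spanned_by (U : {vspace X}) : bool :=
  (U == 0%VS) ||
  [exists b : (\dim U).-tuple (finvect_type X),
     basis_of U b && all (mem A) b].

Definition lattice_of : predArgType := {U : {vspace X} | spanned_by U}.

HB.instance Definition _ := SubType.on lattice_of.
HB.instance Definition _ := Finite.on lattice_of.
HB.instance Definition _ :=
  [SubChoice_isSubPOrder of lattice_of by <: with subspace_display].

Fact spanned_by0 : spanned_by 0%VS.
Proof. by rewrite /spanned_by eqxx. Qed.

Definition lattice0 : lattice_of := Sub 0%VS spanned_by0.

Definition whitney (i : nat) : int :=
  \sum_(U : lattice_of | \dim (val U) == i) mobius lattice0 U.

Definition distinguishes (V : {vspace X}) : bool :=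
  let VA := [set v in A | v \in V] in (VA == set0) || (VA == [set 0]).

Definition alpha (k : nat) : nat :=
  #|[set V : {vspace X} | (\dim V == k) && distinguishes V]|.

End LatticeOfSet.

(* Main.v *)
Require Import Defs.
From mathcomp Require Import all_boot all_order all_algebra all_field.
Set Implicit Arguments.
Unset Strict Implicit.
Unset Printing Implicit Defensive.
Import Order.TTheory GRing.Theory Num.Theory.
Local Open Scope ring_scope.

(** Every subspace V contains a largest member of L(A), the span W of the
elements of A lying in V: a member U of L(A) has a basis inside A, so U <= V
forces that basis, hence U, into W ([le_largest_sub]). Moreover V distinguishes
A exactly when W = 0 ([distinguishesE]). The defining property of the Moebius
function ([sum_mobius]) therefore expresses the indicator of `V distinguishes A'
as the sum of mu(0, U) over all U in L(A) with U <= W, that is, with U <= V.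

Summing over the V of dimension k and exchanging the two sums, each U in L(A)
contributes mu(0, U) times the number of k-dimensional subspaces containing U.
That number is the q-binomial coefficient (n - dim U, k - dim U)
([card_upper_subspaces]), so it depends on dim U only, and grouping the members
of L(A) by dimension produces the Whitney numbers.

The subspaces above U are counted by induction on the codimension of U in them:
counting the pairs (V, x) with x in V but not in U in two ways relates the
subspaces above U to those above the spaces U + <x>, one dimension higher. This
yields the product formula of the q-binomial coefficient without passing to the
quotient by U. *)

(** * Vector spaces *)

Lemma card_subspace (F : finFieldType) (X : vectType F) (V : {vspace X}) :
  #|[set x : finvect_type X | x \in V]| = (#|F| ^ \dim V)%N.
Proof.
(* Once the record X is opened, its structure and the one carried by
   [finvect_type X] become convertible. *)
case: X V => T cT V; rewrite cardsE.
exact: (@card_vspace F (finvect_type (Vector.Pack cT)) cT V).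
Qed.

Lemma dim_add_line (K : fieldType) (X : vectType K) (U : {vspace X}) (x : X) :
  x \notin U -> \dim (U + <[x]>)%VS = (\dim U).+1.
Proof.
move=> xU; have x0 : x != 0 by apply: contraNneq xU => ->; exact: mem0v.
rewrite dimv_disjoint_sum ?dim_vline ?x0 ?addn1 //.
apply/eqP; rewrite -subv0; apply/subvP => y /memv_capP[yU /vlineP[c yE]].
move: yU; rewrite yE rpredZeq (negbTE xU) orbF => /eqP ->.
by rewrite scale0r mem0v.
Qed.

(** Reading s from its end, a vector is kept when it is independent of those
already kept. *)
Lemma span_sub_basis (K : fieldType) (X : vectType K) (s : seq X) :
  exists2 b : seq X, {subset b <= s} & basis_of <<s>>%VS b.
Proof.
elim: s => [|v s [b bs bB]].
  by exists [::]; rewrite // span_nil nil_basis.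
have sb := span_basis bB.
case: (boolP (v \in <<s>>%VS)) => vs.
  exists b; first by move=> x /bs xs; rewrite inE xs orbT.
  rewrite span_cons; suff -> : (<[v]> + <<s>> = <<s>>)%VS by [].
  by apply/addv_idPr; rewrite -memvE.
exists (v :: b).
  by move=> x; rewrite !inE => /orP[->//|/bs ->]; rewrite orbT.
by rewrite /basis_of !span_cons sb eqxx free_cons sb vs (basis_free bB).
Qed.

(** * Gaussian binomials *)

Lemma qbinom_den_gt0 q s : (1 < q)%N -> (0 < qbinom_den q s)%N.
Proof.
move=> q1; apply: prodn_gt0 => i.
by rewrite subn_gt0 -(expn0 q) ltn_exp2l.
Qed.

Lemma qbinom_numS q r s :
  qbinom_num q r s.+1 = ((q ^ r - 1) * qbinom_num q r.-1 s)%N.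
Proof.
rewrite /qbinom_num big_ord_recl subn0; congr (_ * _)%N.
by apply: eq_bigr => i _; rewrite lift0 -subn1 -subnDA add1n.
Qed.

Lemma qbinom_denS q s :
  qbinom_den q s.+1 = (qbinom_den q s * (q ^ s.+1 - 1))%N.
Proof. by rewrite /qbinom_den big_ord_recr. Qed.

(** When r < s both sides vanish: the numerator has the factor q ^ 0 - 1. *)
Lemma qbinom_nat q (r s : nat) :
  qbinom q r%:Z s%:Z = (qbinom_num q r s %/ qbinom_den q s)%N.
Proof.
rewrite /qbinom /= lez_nat; case: leqP => // ltrs.
rewrite /qbinom_num (bigD1 (Ordinal ltrs)) //= subnn expn0 subnn mul0n.
by rewrite div0n.
Qed.

(** * Subspaces above a given subspace *)

Section Counting.
Variables (F : finFieldType) (X : vectType F).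
Local Notation fX := (finvect_type X).
Implicit Types U V : {vspace X}.

Lemma card_subspaceD U V : (U <= V)%VS ->
  #|[set x : fX | (x \in V) && (x \notin U)]|
    = (#|F| ^ \dim V - #|F| ^ \dim U)%N.
Proof.
move=> sUV; rewrite -!card_subspace.
have <- : [set x : fX | x \in V] :\: [set x : fX | x \in U]
          = [set x : fX | (x \in V) && (x \notin U)].
  by apply/setP => x; rewrite !inE andbC.
rewrite cardsD; congr (_ - _)%N; apply: eq_card => x; rewrite !inE andbC.
by case: (boolP (x \in U)) => //= /(subvP sUV) ->.
Qed.

Definition upper_subspaces U s : {set {vspace X}} :=
  [set V | (U <= V)%VS && (\dim V == (\dim U + s)%N)].

(** Both sides count the pairs (V, x) with V above U and x in V but not in U: for
fixed x, these V are the subspaces above U + <x>. *)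
Lemma card_upper_subspaces_rec U s :
  (#|upper_subspaces U s.+1| * (#|F| ^ (\dim U + s.+1) - #|F| ^ \dim U))%N
  = (\sum_(x : fX | (x : X) \notin U) #|upper_subspaces (U + <[x : X]>)%VS s|)%N.
Proof.
transitivity (\sum_(V in upper_subspaces U s.+1)
   \sum_(x : fX | ((x : X) \notin U) && ((x : X) \in V)) 1)%N.
  rewrite -sum_nat_const; apply: eq_bigr => V; rewrite inE => /andP[sUV /eqP dV].
  rewrite -dV -card_subspaceD // -sum1_card; apply: eq_bigl => x.
  by rewrite inE andbC.
rewrite (exchange_big_dep (fun x : fX => (x : X) \notin U)) /=; last first.
  by move=> V x _ /andP[].
apply: eq_bigr => x xU; rewrite sum1_card; apply: eq_card => V.
rewrite -topredE /= !inE xU /= subv_add -memvE dim_add_line // addSnnS.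
by rewrite andbAC.
Qed.

(** The multiplied-out form of the q-binomial formula, suited to induction: it
also covers the case where s exceeds the codimension of U, both sides being 0. *)
Lemma card_upper_subspaces_den U s :
  (#|upper_subspaces U s| * qbinom_den #|F| s)%N
  = qbinom_num #|F| (\dim {:X} - \dim U) s.
Proof.
elim: s U => [|s IH] U.
  rewrite /qbinom_den /qbinom_num !big_ord0 muln1.
  suff -> : upper_subspaces U 0 = [set U] by rewrite cards1.
  apply/setP => V; rewrite !inE addn0; apply/andP/eqP => [[sUV /eqP dV]|->].
    by apply/esym/eqP; rewrite eqEdim sUV dV /=.
  by rewrite subvv eqxx.
have q1 : (1 < #|F|)%N by exact: finNzRing_gt1.
have dle : (\dim U <= \dim {:X})%N by apply/dimvS/subvf.
have q0 : (0 < #|F| ^ \dim U)%N by rewrite expn_gt0 (ltnW q1).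
(* The factor #|F| ^ \dim U turns #|F| ^ s.+1 - 1 into the number of vectors of
   a subspace above U that lie outside U, as the double counting requires. *)
apply/eqP; rewrite -(eqn_pmul2r q0) qbinom_denS qbinom_numS; apply/eqP.
have -> : (#|upper_subspaces U s.+1| * (qbinom_den #|F| s * (#|F| ^ s.+1 - 1))
            * #|F| ^ \dim U
  = (#|upper_subspaces U s.+1| * (#|F| ^ (\dim U + s.+1) - #|F| ^ \dim U))
     * qbinom_den #|F| s)%N.
  rewrite expnD -[X in (_ * _ - X)%N]muln1 -mulnBr -!mulnA.
  by congr (_ * _)%N; rewrite mulnC mulnAC mulnC mulnA.
rewrite card_upper_subspaces_rec big_distrl /=.
under eq_bigr => x xU do rewrite IH dim_add_line // subnS.
rewrite sum_nat_const mulnAC; congr (_ * _)%N.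
rewrite mulnBl mul1n -expnD subnK //.
have <- := card_subspaceD (subvf U).
by apply: eq_card => x; rewrite !inE memvf.
Qed.

Lemma card_upper_subspaces U k :
  #|[set V : {vspace X} | (U <= V)%VS && (\dim V == k)]|
  = qbinom #|F| ((\dim {:X})%:Z - (\dim U)%:Z) (k%:Z - (\dim U)%:Z).
Proof.
case: (leqP (\dim U) k) => [dk|kd]; last first.
  rewrite {1}/qbinom subr_ge0 lez_nat leqNgt kd /=.
  apply: eq_card0 => V; rewrite !inE; apply/negP => /andP[/dimvS sUV /eqP dV].
  by move: sUV; rewrite dV leqNgt kd.
have dle : (\dim U <= \dim {:X})%N by apply/dimvS/subvf.
rewrite !subzn // qbinom_nat -card_upper_subspaces_den mulnK.
  by apply: eq_card => V; rewrite !inE subnKC.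
exact/qbinom_den_gt0/finNzRing_gt1.
Qed.

End Counting.

(** * The largest member of L(A) below a subspace *)

Section Lattice.
Variables (F : finFieldType) (X : vectType F).
Variable A : {set finvect_type X}.
Implicit Types V : {vspace X}.

Definition trace_seq V : seq X :=
  enum [set v in A | (v : X) \in V].

Lemma mem_trace_seq V (x : finvect_type X) :
  ((x : X) \in trace_seq V) = (x \in A) && ((x : X) \in V).
Proof.
transitivity ((x : finvect_type X) \in [set v in A | (v : X) \in V]).
  exact: (@mem_enum (finvect_type X) (mem [set v in A | (v : X) \in V]) x).
exact: (@in_set (finvect_type X)).
Qed.

Definition span_trace V : {vspace X} := <<trace_seq V>>%VS.

Lemma span_trace_subv V : (span_trace V <= V)%VS.
Proof. by apply/span_subvP => x; rewrite mem_trace_seq => /andP[]. Qed.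

Lemma mem_span_trace V (v : finvect_type X) :
  v \in A -> (v : X) \in V -> (v : X) \in span_trace V.
Proof. by move=> vA vV; apply: memv_span; rewrite mem_trace_seq vA. Qed.

Lemma spanned_by_trace V : spanned_by A (span_trace V).
Proof.
apply/orP; right; rewrite /span_trace.
have [b bs bB] := span_sub_basis (trace_seq V).
set s := trace_seq V in bs bB *.
have szb : size b == \dim <<s>>%VS by rewrite (size_basis (X := in_tuple b) bB).
apply/existsP; exists (Tuple szb : (\dim <<s>>%VS).-tuple (finvect_type X)).
apply/andP; split; first exact: bB.
by apply/allP => x /= /bs; rewrite mem_trace_seq => /andP[].
Qed.

Definition largest_sub V : lattice_of A :=
  Sub (span_trace V) (spanned_by_trace V).

(** A basis of U made of elements of A lies in V as soon as U does, and is then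
among the vectors that span [largest_sub V]. *)
Lemma le_largest_sub (U : lattice_of A) V :
  (val U <= V)%VS = (U <= largest_sub V)%O.
Proof.
rewrite -[RHS]/(val U <= span_trace V)%VS.
apply/idP/idP => [sUV|sU]; last exact: subv_trans sU (span_trace_subv V).
case/orP: (valP U) => [/eqP ->|/existsP[b /andP[bB /allP bA]]]; first exact: sub0v.
rewrite -(span_basis bB); apply/span_subvP => x xb.
apply: mem_span_trace; first exact: bA.
exact/(subvP sUV)/(basis_mem bB).
Qed.

Lemma distinguishesE V : distinguishes A V = (largest_sub V == lattice0 A).
Proof.
rewrite -val_eqE /= -subv0.
apply/idP/idP.
  move=> h; apply/span_subvP => x; rewrite mem_trace_seq => xAV.
  have {}xAV : (x : finvect_type X) \in [set v in A | (v : X) \in V].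
    by rewrite inE.
  rewrite memv0; move: h; rewrite /distinguishes /= => /orP[]/eqP h.
    by rewrite h inE in xAV.
  by rewrite h inE in xAV.
move=> h; rewrite /distinguishes /=; set VA := [set v in A | _].
rewrite orbC.
suff : VA \subset [set (0 : finvect_type X)] by rewrite subset1.
apply/subsetP => v; rewrite inE => /andP[vA vV]; rewrite inE.
by have /(subvP h) := mem_span_trace vA vV; rewrite memv0.
Qed.

Lemma lattice0_le (U : lattice_of A) : (lattice0 A <= U)%O.
Proof. exact: (sub0v (val U)). Qed.

End Lattice.

(** * Moebius inversion *)

Lemma sum_mobius d (T : finPOrderType d) (x y : T) : (x <= y)%O ->
  \sum_(z | (x <= z <= y)%O) mobius x z = (x == y)%:R.
Proof.
move=> lexy; rewrite (bigD1 y) ?lexy ?lexx //=.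
case: (eqVneq x y) => [<-|nxy].
  rewrite mobius_xx big1 ?addr0 // => z /andP[/le_anti ->].
  by rewrite eqxx.
rewrite mobius_lt ?lt_neqAle ?nxy ?lexy //.
rewrite addrC; apply/eqP; rewrite subr_eq0; apply/eqP.
by apply: eq_bigl => z; rewrite lt_neqAle; case: eqP; rewrite ?andbF ?andbT.
Qed.

Theorem theorem3p2 (q n : nat) (F : finFieldType) (hq : #|F| = q)
    (X : vectType F) (hn : \dim {:X} = n) (hn1 : (1 <= n)%N)
    (A : {set finvect_type X}) (k : nat) :
  (alpha A k)%:Z =
  \sum_(0 <= i < k.+1)
     whitney A i * (qbinom q (n%:Z - i%:Z) (k%:Z - i%:Z))%:Z.
Proof.
subst q n.
transitivity (\sum_(U : lattice_of A) mobius (lattice0 A) U *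
   #|[set V : {vspace X} | (val U <= V)%VS && (\dim V == k)]|%:Z).
  (* Moebius inversion applied to each V, then the sums are exchanged. *)
  have -> : (alpha A k)%:Z
    = \sum_(V : {vspace X} | \dim V == k) (lattice0 A == largest_sub A V)%:R :> int.
    rewrite /alpha -sum1_card -natr_sum -[LHS]natz; congr (_%:R).
    rewrite -big_mkcondr; apply: eq_bigl => V.
    by rewrite inE distinguishesE [largest_sub A V == _]eq_sym.
  under eq_bigr => V _ do rewrite -(sum_mobius (lattice0_le (largest_sub A V))).
  rewrite (exchange_big_dep predT) //=; apply: eq_bigr => U _.
  rewrite sumr_const -mulr_natr natz; congr (_ * _%:Z); apply: eq_card => V.
  by rewrite -topredE /= !inE lattice0_le /= le_largest_sub andbC.
(* Grouping by dimension: the members U of dimension greater than k lie in no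
   subspace of dimension k, so they drop out. *)
rewrite (bigID (fun U : lattice_of A => (\dim (val U) < k.+1)%N)) /=.
rewrite [X in _ + X]big1 ?addr0; last first.
  move=> U; rewrite -leqNgt => kU; rewrite card_upper_subspaces /qbinom.
  by rewrite subr_ge0 lez_nat leqNgt kU mulr0.
rewrite big_mkord
  (partition_big
     (fun U : lattice_of A => inord (\dim (val U)) : 'I_k.+1) predT) //=.
apply: eq_bigr => i _; rewrite /whitney big_distrl /=.
apply: eq_big => [U|U /andP[dU /eqP <-]].
  apply/andP/eqP => [[dU /eqP <-]|->]; first by rewrite inordK.
  by rewrite ltn_ord inord_val eqxx.
by rewrite card_upper_subspaces inordK.
Qed.
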